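(* Let $M$ be a smooth manifold of dimension $m$ equipped with an $A$-structure of rank $n$, where $n<m$, such that for every $x\in M$ the fibre $A_x$ is an $n$-dimensional real algebra (under composition of endomorphisms), so that $V:=T_xM$ is an $A_x$-module under evaluation. If for every $x\in M$ there exists $X\in V=T_xM$ such that $\dim A(X)=n$, then the $A$-structure has weak generic rank $n$.
   Context: Let $M$ be a smooth manifold of dimension $m$. An $A$-structure of rank $\ell$ on $M$ ($\ell<m$) is a smooth vector subbundle $A\subset T^*M\otimes TM$ of rank $\ell$ (so each fibre $A_x$ is an $\ell$-dimensional real vector space of endomorphisms of $T_xM$) such that the identity $E=\mathrm{id}_{T_xM}$ belongs to $A_x$ for every $x\in M$. The fibre $A_x$ is called an algebra if $f\circ g\in A_x$ for all $f,g\in A_x$. For $X\in T_xM$ the $A$-hull of $X$ is the vector subspace $A(X)=\{F(X)\mid F\in A_x\}\subset T_xM$. An $A$-structure of rank $\ell$ has weak generic rank $\ell$ if for each $x\in M$ the set $\mathcal V=\{X\in T_xM\mid \dim A(X)=\ell\}$ is open and dense in $T_xM$. *)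

(* Defs.v *)
From HB Require Import structures.
From mathcomp Require Import all_boot all_order all_algebra.
From mathcomp Require Import all_classical all_reals all_analysis.

Set Implicit Arguments.
Unset Strict Implicit.
Unset Printing Implicit Defensive.

Import Order.TTheory GRing.Theory Num.Theory.
Import numFieldNormedType.Exports.

Local Open Scope classical_set_scope.
Local Open Scope ring_scope.

Section Smooth.
Context {R : realType} {V W : normedModType R}.

(* [C_k] regularity on an open set [U] of a finite dimensional space [V], by
   iterated Frechet differentiation; testing the differential on every vector
   [v] is enough since [V] is finite dimensional. *)
Fixpoint Ck (k : nat) (U : set V) (f : V -> W) : Prop :=
  if k is k'.+1 then
    (forall p, U p -> differentiable f p) /\
    (forall v, Ck k' U (fun p => 'd f p v))
  else forall p, U p -> {for p, continuous f}.

Definition smooth_on (U : set V) (f : V -> W) : Prop := forall k, Ck k U f.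

End Smooth.

(* The values of [cfun] off [cdom], and of [cinv] off [cfun @` cdom], are
   irrelevant. *)
Record chart (R : realType) (m : nat) (M : topologicalType) := Chart {
  cdom : set M;
  cfun :> M -> 'rV[R]_m;
  cinv : 'rV[R]_m -> M;
  cdom_open : open cdom;
  cim_open : open (cfun @` cdom);
  cfun_continuous : {within cdom, continuous cfun};
  cinv_continuous : {within cfun @` cdom, continuous cinv};
  cfunK : forall x, cdom x -> cinv (cfun x) = x }.

Section DiffLocal.
Context {R : realType} {V W : normedModType R}.

Lemma near_diff (f g : V -> W) (p : V) : (\forall q \near p, f q = g q) ->
  differentiable f p -> 'd g p = 'd f p :> (V -> W).
Proof.
move=> fg df; apply: diff_unique; first exact: diff_continuous.
have /diff_locallyP[_ /eqaddoP fE] := df.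
apply/eqaddoP => e e0; have := fE e e0; have gfp := nbhs_singleton fg.
move: fg; rewrite (near_shift 0 p) subr0 => fg.
apply: filterS2 fg => h /= fgh; rewrite !fctE /= -gfp -fgh.
exact.
Qed.

End DiffLocal.

Section Compatible.
Context {R : realType} {m : nat} {M : topologicalType}.

Definition transition (c d : chart R m M) : 'rV[R]_m -> 'rV[R]_m :=
  d \o cinv c.

Definition compatible (c d : chart R m M) : Prop :=
  smooth_on (c @` (cdom c `&` cdom d)) (transition c d) /\
  smooth_on (d @` (cdom c `&` cdom d)) (transition d c).

End Compatible.

Record manifold (R : realType) (m : nat) := Manifold {
  mspace :> topologicalType;
  manifold_hausdorff : hausdorff_space mspace;
  manifold_second_countable : @second_countable mspace;
  atlas : set (chart R m mspace);
  atlas_cover : forall x, exists2 c, atlas c & cdom c x;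
  atlas_compatible : forall c d, atlas c -> atlas d -> compatible c d;
  atlas_maximal : forall c, (forall d, atlas d -> compatible c d) -> atlas c }.

Section Tangent.
Context {R : realType} {m : nat} {M : manifold R m}.
Implicit Types (x : M) (c d : chart R m M).

Definition chart_at x : set (chart R m M) := [set c | atlas c /\ cdom c x].

(* A tangent vector at [x] is the family of its coordinate vectors in the
   charts around [x], related by the differentials of the transition maps.
   Families are indexed by all charts, with the value 0 at irrelevant ones. *)
Definition tangent_family x (v : chart R m M -> 'rV[R]_m) : Prop :=
  (forall c, ~ chart_at x c -> v c = 0) /\
  (forall c d, chart_at x c -> chart_at x d ->
     v d = 'd (transition c d) (c x) (v c)).

Definition tangent_pred x : {pred chart R m M -> 'rV[R]_m} :=
  fun v => `[< tangent_family x v >].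

Lemma tangent_submod_closed x : submod_closed (tangent_pred x).
Proof.
split=> [|a u v /asboolP[u0 uE] /asboolP[v0 vE]]; apply/asboolP; split => //.
- by move=> c d _ _; rewrite linear0.
- by move=> c nc; rewrite !fctE u0// v0// scaler0 addr0.
- by move=> c d xc xd; rewrite !fctE linearP -uE// -vE.
Qed.

HB.instance Definition _ x :=
  GRing.isSubmodClosed.Build _ _ (tangent_pred x) (tangent_submod_closed x).

Record tangent x := Tangent {
  tangent_val : chart R m M -> 'rV[R]_m;
  _ : tangent_val \in tangent_pred x }.

HB.instance Definition _ x := [isSub for @tangent_val x].
HB.instance Definition _ x := [Choice of tangent x by <:].
HB.instance Definition _ x := [SubChoice_isSubLmodule of tangent x by <:].

Definition coord x c (X : tangent x) : 'rV[R]_m := val X c.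

Definition tangent_push x c (v : 'rV[R]_m) : chart R m M -> 'rV[R]_m :=
  fun d => if `[< chart_at x d >] then 'd (transition c d) (c x) v else 0.

(* The tangent vector at [x] with coordinates [v] in [c] (0 if [c] is not a
   chart around [x]). *)
Definition tangent_of x c (v : 'rV[R]_m) : tangent x :=
  insubd (0 : tangent x) (tangent_push x c v).


Lemma chart_im_nbhs x c (U : set M) : cdom c x -> open U -> U x ->
  nbhs (c x) (c @` (cdom c `&` U)).
Proof.
move=> cx oU Ux; have := @cinv_continuous _ _ _ c.
rewrite continuous_open_subspace; last exact: cim_open.
have icx : (c @` cdom c) (c x) by exists x.
move=> /(_ (c x) (mem_set icx)) ci.
have : nbhs (c x) (cinv c @^-1` U).
  by apply: ci; rewrite cfunK//; exact: open_nbhs_nbhs.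
have : nbhs (c x) (c @` cdom c).
  by apply: open_nbhs_nbhs; split=> //; exact: cim_open.
apply: filterS2 => _ [y cy <-] /=; rewrite cfunK// => Uy.
by exists y.
Qed.

Lemma transition_differentiable x c d : chart_at x c -> chart_at x d ->
  differentiable (transition c d) (c x).
Proof.
move=> [ac cx] [ad dx]; have [/(_ 1%N)[+ _] _] := atlas_compatible ac ad.
by apply; exists x.
Qed.

Lemma transition_comp x c d e (v : 'rV[R]_m) :
  chart_at x c -> chart_at x d -> chart_at x e ->
  'd (transition d e) (d x) ('d (transition c d) (c x) v) =
  'd (transition c e) (c x) v.
Proof.
move=> xc xd xe; have [[_ cx] [_ dx]] := (xc, xd).
have tcx : transition c d (c x) = d x by rewrite /transition /= cfunK.
have dcd := transition_differentiable xc xd.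
have dde := transition_differentiable xd xe.
have dce := transition_differentiable xc xe.
have near_comp : \forall p \near c x,
    transition c e p = (transition d e \o transition c d) p.
  have := chart_im_nbhs cx (cdom_open d) dx.
  apply: filterS => _ [y [cy dy] <-].
  by rewrite /transition /= cfunK// cfunK.
have diffE := near_diff near_comp dce.
have dde' : differentiable (transition d e) (transition c d (c x)).
  by rewrite tcx.
have := diff_comp dcd dde'; rewrite tcx => compE.
by have /(congr1 (fun h : 'rV_m -> 'rV_m => h v)) := etrans (esym compE) diffE.
Qed.

Lemma transition_id x c (v : 'rV[R]_m) : chart_at x c ->
  'd (transition c c) (c x) v = v.
Proof.
move=> [ac cx]; have near_id : \forall p \near c x, p = transition c c p.
  have := chart_im_nbhs cx (cdom_open c) cx.
  by apply: filterS => _ [y [cy _] <-]; rewrite /transition /= cfunK.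
have did : is_diff (c x) id (id : 'rV[R]_m -> 'rV[R]_m) := is_diff_id _.
have diffE := near_diff near_id (@ex_diff _ _ _ _ _ _ _ did).
have idE := @diff_val _ _ _ _ _ _ _ did.
by have /(congr1 (fun h : 'rV_m -> 'rV_m => h v)) := etrans diffE idE.
Qed.

Lemma tangent_pushP x c (v : 'rV[R]_m) : chart_at x c ->
  tangent_family x (tangent_push x c v).
Proof.
move=> xc; split=> [d nd|d e xd xe].
  by rewrite /tangent_push; case: asboolP.
rewrite /tangent_push (asboolT xd) (asboolT xe).
by apply/esym; apply: transition_comp.
Qed.

Lemma coord_transition x c d (X : tangent x) :
  chart_at x c -> chart_at x d ->
  coord d X = 'd (transition c d) (c x) (coord c X).
Proof. by move=> xc xd; have /asboolP[_] := valP X; apply. Qed.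

Lemma coord_tangent_of x c d (v : 'rV[R]_m) :
  chart_at x c -> chart_at x d ->
  coord d (tangent_of x c v) = 'd (transition c d) (c x) v.
Proof.
move=> xc xd; rewrite /coord /tangent_of insubdK; last first.
  by apply/asboolP; exact: tangent_pushP.
by rewrite /tangent_push (asboolT xd).
Qed.

Lemma tangent_ofK x c : chart_at x c ->
  cancel (tangent_of x c) (@coord x c).
Proof.
by move=> xc v; apply: etrans (coord_tangent_of v xc xc) (transition_id v xc).
Qed.

Lemma coordK x c : chart_at x c -> cancel (@coord x c) (tangent_of x c).
Proof.
move=> xc X; apply/val_inj/funext => d; have [xd|nd] := pselect (chart_at x d).
  apply: etrans (coord_tangent_of (coord c X) xc xd) _.
  by apply/esym; exact: coord_transition.
by have /asboolP[->//] := valP (tangent_of x c (coord c X));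
   have /asboolP[->] := valP X.
Qed.

Lemma coord_is_linear x c : linear (@coord x c).
Proof. by move=> a X Y; rewrite /coord linearP. Qed.

Lemma chart_ex x : exists c, chart_at x c.
Proof. by have [c] := atlas_cover x; exists c. Qed.

Definition some_chart x : chart R m M := projT1 (cid (chart_ex x)).

Lemma some_chartP x : chart_at x (some_chart x).
Proof. exact: (projT2 (cid (chart_ex x))). Qed.

Lemma tangent_vector_axiom x : Vector.axiom m (tangent x).
Proof.
exists (@coord x (some_chart x)); first exact: coord_is_linear.
by exists (tangent_of x (some_chart x));
  [apply: coordK|apply: tangent_ofK]; exact: some_chartP.
Qed.

HB.instance Definition _ x :=
  Lmodule_hasFinDim.Build R (tangent x) (tangent_vector_axiom x).

(* The canonical topology of the finite dimensional space [tangent x]; by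
   [open_tangentE], the choice of the chart is irrelevant. *)
HB.instance Definition _ x :=
  Topological.copy (tangent x) (initial_topology (@coord x (some_chart x))).

Lemma open_tangentE x c (O : set (tangent x)) : chart_at x c ->
  open O <-> open (tangent_of x c @^-1` O).
Proof.
move=> xc; have xs := some_chartP x; set s := some_chart x in xs.
have cts d e : chart_at x d -> chart_at x e ->
    continuous ('d (transition d e) (d x) : 'rV[R]_m -> 'rV[R]_m).
  by move=> xd xe; apply: diff_continuous; exact: transition_differentiable.
split=> [[B oB <-]|oO].
- rewrite (_ : _ @^-1` _ = 'd (transition c s) (c x) @^-1` B); last first.
    by apply/seteqP; split=> v /=; rewrite coord_tangent_of.
  by apply: open_comp => // v _; exact: cts.
- exists ('d (transition s c) (s x) @^-1` (tangent_of x c @^-1` O)).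
    by apply: open_comp => // v _; exact: cts.
  by apply/seteqP; split=> X /=;
    rewrite -(coord_transition X xs xc) (coordK xc).
Qed.

End Tangent.
Arguments tangent {R m M} x.
Arguments coord {R m M x} c X.
Arguments tangent_of {R m M} x c v.

Section AStructure.
Context {R : realType} {m : nat} (M : manifold R m).

(* The matrix of [F], acting on row vectors, in the coordinates of [c]. *)
Definition endo_mx (x : M) (c : chart R m M) (F : 'End(tangent x)) : 'M[R]_m :=
  lin1_mx (fun v => coord c (F (tangent_of x c v))).

Definition smooth_endo_section (U : set M)
    (s : forall x : M, 'End(tangent x)) : Prop :=
  forall c, atlas c ->
    smooth_on (c @` (cdom c `&` U))
      (fun p => endo_mx c (s (cinv c p))).

(* Smooth subbundles of [T^*M (x) TM = End(TM)], through local frames. *)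
Definition smooth_subbundle (l : nat)
    (A : forall x : M, {vspace 'End(tangent x)}) : Prop :=
  forall x0 : M, exists (U : set M) (s : 'I_l -> forall x : M, 'End(tangent x)),
    [/\ open U, U x0,
        forall i, smooth_endo_section U (s i) &
        forall x, U x -> basis_of (A x) [tuple s i x | i < l]].

Record A_structure (l : nat) := AStructure {
  fibre :> forall x : M, {vspace 'End(tangent x)};
  rank_lt : (l < m)%N;
  fibre_smooth : smooth_subbundle l fibre;
  fibre_id : forall x, \1%VF \in fibre x }.

Definition is_algebra (x : M) (Ax : {vspace 'End(tangent x)}) : Prop :=
  forall f g, f \in Ax -> g \in Ax -> (f \o g)%VF \in Ax.

Definition hull (x : M) (Ax : {vspace 'End(tangent x)}) (X : tangent x) :
    {vspace tangent x} :=
  (linfun (fun F : 'End(tangent x) => F X) @: Ax)%VS.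

Definition weak_generic_rank (l : nat) (A : A_structure l) : Prop :=
  forall x : M, let V := [set X : tangent x | \dim (hull (A x) X) = l] in
    open V /\ dense V.

Lemma memv_hull (x : M) (Ax : {vspace 'End(tangent x)}) (X Y : tangent x) :
  Y \in hull Ax X <-> exists2 F, F \in Ax & Y = F X.
Proof.
have ev_linear : linear (fun F : 'End(tangent x) => F X).
  by move=> a F G; rewrite add_lfunE scale_lfunE.
pose ev := HB.pack (fun F : 'End(tangent x) => F X)
  (GRing.isLinear.Build _ _ _ _ _ ev_linear)
  : {linear 'End(tangent x) -> tangent x}.
split=> [/memv_imgP[F FA ->]|[F FA ->]].
  by exists F => //; rewrite (lfunE ev).
by rewrite -[F X](lfunE ev); exact: memv_img.
Qed.

Lemma dim_fibre (l : nat) (A : A_structure l) (x : M) : \dim (A x) = l.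
Proof.
have [U [s [_ Ux _ /(_ x Ux) bA]]] := fibre_smooth A x.
exact: size_basis bA.
Qed.

End AStructure.

(* Main.v *)
Require Import Defs.
From HB Require Import structures.
From mathcomp Require Import all_boot all_order all_algebra.
From mathcomp Require Import all_classical all_reals all_analysis.

Import Order.TTheory GRing.Theory Num.Theory.
Import numFieldNormedType.Exports.

Local Open Scope ring_scope.

(** Both properties are pointwise and linear-algebraic. In a chart around [x],
    and for a basis [F_1, ..., F_n] of the fibre, the vectors [F_i X] are the
    rows of an [n x m] matrix [K X] which is linear in [X], and the hull of [X]
    has dimension [n] exactly when these rows are independent
    ([dim_hull_row_free]). So it suffices to see that a linear family of
    matrices with independent rows at one point has independent rows on an
    open dense set.

    Row independence is the existence of a right inverse. If [K v *m P = 1],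
    then [\det (K w *m P)] does not vanish for [w] close to [v], and [K w] has
    independent rows there ([open_row_free]). If [K v0 *m P = 1] and [v] is
    arbitrary, then [K (v - t v0) *m P = K v *m P - t], which is invertible
    unless [t] is one of the finitely many eigenvalues of [K v *m P]; hence
    [v - t v0] is a good point for arbitrarily small [t]
    ([dense_row_free]). Charts carry both facts back to the tangent space, since
    they define its topology. *)

Lemma row_free_mulmxl (F : fieldType) (m n p : nat)
    (A : 'M[F]_(m, n)) (B : 'M[F]_(n, p)) :
  row_free (A *m B) -> row_free A.
Proof.
move=> /row_free_inj AB; apply: inj_row_free => v vA0.
by apply: AB; rewrite mulmxA vA0 !mul0mx.
Qed.

(** A polynomial has fewer roots than its size, while the numbers
    [e / (k + 2)] are pairwise distinct and smaller than [e]. *)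
Lemma nonroot_small (R : realFieldType) (q : {poly R}) (e : R) :
  q != 0 -> 0 < e -> exists2 t : R, `|t| < e & ~~ root q t.
Proof.
move=> q0 e0; pose t (k : nat) := e / k.+2%:R.
have tlt k : `|t k| < e.
  rewrite ger0_norm ?divr_ge0 ?ltW//.
  by rewrite ltr_pdivrMr ?ltr0n// ltr_pMr// ltr1n.
have tinj : injective t.
  move=> j k /(mulfI (lt0r_neq0 e0))/invr_inj/eqP.
  by rewrite eqr_nat => /eqP[].
have [/(max_poly_roots q0)|] :=
    boolP (all (root q) [seq t k | k <- iota 0 (size q)]).
  rewrite (map_inj_uniq tinj) iota_uniq size_map size_iota ltnn.
  by move=> /(_ isT).
by case/allPn => _ /mapP[k _ ->] nr; exists (t k).
Qed.

Lemma continuous_det (R : realType) (T : topologicalType) (n : nat)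
    (A : T -> 'M[R]_n) :
  (forall i j, continuous (fun x => A x i j)) ->
  continuous (fun x => \det (A x)).
Proof.
move=> cA x; apply: (cvg_big add_continuous) => s _.
apply: cvgM; first exact: cvg_cst.
by apply: (cvg_big (@mul_continuous R)) => i _; exact: cA.
Qed.

Lemma continuous_linear_rV (R : realType) (m : nat)
    (f : {linear 'rV[R]_m -> R^o}) : continuous f.
Proof.
have -> : f = (fun v => \sum_l v 0 l * f (delta_mx 0 l)) :> (_ -> _).
  apply/funext => v; rewrite {1}(row_sum_delta v) linear_sum.
  by apply: eq_bigr => l _; rewrite linearZ.
move=> v; have nv := @nbhs_filter _ v.
apply: (cvg_big add_continuous) => l _.
by apply: cvgM; [exact: coord_continuous|exact: cvg_cst].
Qed.

Section LinearFamily.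
Context {R : realType} {m n p : nat}.
Variable K : {linear 'rV[R]_m -> 'M[R]_(n, p)}.

(** A right inverse [P] of [K v] need not be one of [K w] for [w] near [v], but
    [K w *m P] stays invertible because its determinant is continuous. *)
Lemma open_row_free : open [set v | row_free (K v)]%classic.
Proof.
rewrite openE => v /= /row_freeP[P KP1].
pose D w := \det (K w *m P).
have cD : continuous D.
  apply: continuous_det => i j.
  have lin : linear (fun w => (K w *m P) i j : R^o).
    by move=> a u w; rewrite linearP mulmxDl -scalemxAl !mxE.
  pose f := HB.pack (fun w => (K w *m P) i j : R^o)
    (GRing.isLinear.Build _ _ _ _ _ lin) : {linear 'rV[R]_m -> R^o}.
  exact: (@continuous_linear_rV _ _ f).
have : nbhs v (D @^-1` [set y | y != 0])%classic.
  apply: cD; apply: open_nbhs_nbhs; split; first exact: open_neq.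
  by rewrite /= /D KP1 det1 oner_neq0.
apply: filterS => w /= Dw; apply: (@row_free_mulmxl _ _ _ _ _ P).
by rewrite row_free_unit unitmxE unitfE.
Qed.

(** Along the line through [v] in the direction of a good point [v0], a right
    inverse [P] of [K v0] turns [K] into the pencil [K v *m P - t], which is
    singular only at eigenvalues. *)
Lemma dense_row_free (v0 : 'rV[R]_m) :
  row_free (K v0) -> dense [set v | row_free (K v)]%classic.
Proof.
move=> /row_freeP[P KP1] O [v Ov] oO.
have line : continuous (fun t : R => v - t *: v0).
  by move=> t; apply: cvgB; [exact: cvg_cst|exact: cvgZr_tmp].
have /nbhs_ballP[e /= e0 eO] :
    nbhs (0 : R) ((fun t => v - t *: v0) @^-1` O)%classic.
  by apply: line; rewrite scale0r subr0; exact: open_nbhs_nbhs.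
have qn0 := monic_neq0 (char_poly_monic (K v *m P)).
have [t te] := nonroot_small _ _ _ qn0 e0.
rewrite -eigenvalue_root_char negbK kermx_eq0 => Kt.
exists (v - t *: v0); split.
  by apply: eO; rewrite -ball_normE /= sub0r normrN.
apply: (@row_free_mulmxl _ _ _ _ _ P).
by rewrite linearB linearZ /= mulmxBl -scalemxAl KP1 scalemx1.
Qed.

End LinearFamily.

Section Hull.
Context {R : realType} {m n : nat} {M : manifold R m}.
Variables (x : M) (c : chart R m M) (b : n.-tuple 'End(tangent x)).

HB.instance Definition _ := GRing.isLinear.Build R (tangent x) 'rV[R]_m _
  (Defs.coord c) (coord_is_linear c).

(** The evaluations [X |-> F_i X] in the coordinates of [c], stacked so that
    independence of the [F_i X] becomes independence of the rows. *)
Definition hull_mx (v : 'rV[R]_m) : 'M[R]_(n, m) :=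
  \matrix_i Defs.coord c (tnth b i (tangent_of x c v)).

Hypothesis xc : chart_at x c.

Lemma tangent_of_is_linear : linear (tangent_of x c).
Proof.
move=> a u v; apply: (can_inj (coordK xc)).
by rewrite linearP /= !(tangent_ofK xc).
Qed.

Lemma hull_mx_is_linear : linear hull_mx.
Proof.
move=> a u v; apply/row_matrixP => i; rewrite linearP /= !rowK.
by rewrite tangent_of_is_linear !linearP.
Qed.

Definition hull_mx_linear : {linear 'rV[R]_m -> 'M[R]_(n, m)} :=
  HB.pack hull_mx (GRing.isLinear.Build _ _ _ _ _ hull_mx_is_linear).

(** The hull is spanned by the [n] vectors [F_i X], so it has dimension [n]
    exactly when they are free, that is, when their coordinates are. *)
Lemma dim_hull_row_free (Ax : {vspace 'End(tangent x)}) (X : tangent x) :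
  basis_of Ax b ->
  (\dim (hull Ax X) = n) <-> row_free (hull_mx (Defs.coord c X)).
Proof.
move=> bA; have ev_linear : linear (fun F : 'End(tangent x) => F X).
  by move=> a F G; rewrite add_lfunE scale_lfunE.
pose ev := HB.pack (fun F : 'End(tangent x) => F X)
  (GRing.isLinear.Build _ _ _ _ _ ev_linear)
  : {linear 'End(tangent x) -> tangent x}.
pose bX := [tuple of map (linfun ev) b].
have bXE (i : 'I_n) : bX`_i = tnth b i X.
  by rewrite -tnth_nth tnth_map lfunE.
have -> : hull Ax X = <<bX>>%VS by rewrite /hull -(span_basis bA) limg_span.
have coord_inj := can_inj (coordK xc).
have cX u :
    u *m hull_mx (Defs.coord c X) = Defs.coord c (\sum_i u 0 i *: bX`_i).
  rewrite mulmx_sum_row.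
  have -> : Defs.coord c (\sum_i u 0 i *: bX`_i) =
      \sum_i u 0 i *: Defs.coord c bX`_i.
    by rewrite linear_sum; apply: eq_bigr => i _; rewrite linearZ.
  by apply: eq_bigr => i _; rewrite rowK bXE (coordK xc).
have coord0 : Defs.coord c (0 : tangent x) = 0 by rewrite linear0.
have -> : (\dim <<bX>> = n) <-> free bX.
  by rewrite /free size_tuple; split=> /eqP.
split=> [/freeP bf|bf].
  apply: inj_row_free => u; rewrite cX -coord0 => /coord_inj/bf u0.
  by apply/rowP => i; rewrite u0 mxE.
apply/freeP => k k0 i; pose u : 'rV_n := \row_i k i.
have : u *m hull_mx (Defs.coord c X) = 0 *m hull_mx (Defs.coord c X).
  rewrite mul0mx cX (eq_bigr (fun j => k j *: bX`_j)) ?k0// => j _.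
  by rewrite mxE.
by move/(row_free_inj bf)/rowP/(_ i); rewrite !mxE.
Qed.

End Hull.

Theorem theorem3p2 (R : realType) (m n : nat) (M : manifold R m)
    (A : A_structure M n)
    (Aalg : forall x : M, is_algebra (A x))
    (Afull : forall x : M, exists X : tangent x, \dim (hull (A x) X) = n) :
  weak_generic_rank A.
Proof.
move=> x; have [X0 X0full] := Afull x; have [c xc] := chart_ex x.
have [U [s [_ Ux _ /(_ x Ux) bA]]] := fibre_smooth A x.
pose K := hull_mx_linear _ c [tuple s i x | i < n] xc.
have preV : (tangent_of x c @^-1` [set X | \dim (hull (A x) X) = n] =
    [set v | row_free (K v)])%classic.
  apply/seteqP; split=> v /=; rewrite (dim_hull_row_free _ _ _ xc _ _ bA);
  by rewrite (tangent_ofK xc).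
split; first by apply/(open_tangentE _ xc); rewrite preV; exact: open_row_free.
move=> O [X OX] /(open_tangentE _ xc) oO.
move: X0full; rewrite (dim_hull_row_free _ _ _ xc _ _ bA) => X0full.
have O0 : (tangent_of x c @^-1` O !=set0)%classic.
  by exists (Defs.coord c X); rewrite /= (coordK xc).
have [v [Ov]] := dense_row_free K _ X0full _ O0 oO.
by rewrite -preV; exists (tangent_of x c v).
Qed.
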